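(* Let $t$ be a term and $v$ a value with $t \to_{\bar{\mathsf{sh}}}^* v$. Then for any type derivation $\pi$ with conclusion $\vdash t \colon \mathbf{0}$ (empty environment, empty multiset type), $\mathrm{leng}_{\beta_v}(t) = |\pi|$.
   Context: Terms: $t ::= x \mid \lambda x.t \mid tu$ up to $\alpha$-conversion; values are variables and abstractions. Balanced contexts: $B ::= [\cdot] \mid (\lambda x.B)t \mid Bt \mid tB$. Root rules: $(\lambda x.t)v \mapsto_{\beta_v} t\{v/x\}$ ($v$ value); $(\lambda x.t)us \mapsto_{\sigma_1} (\lambda x.ts)u$ if $x\notin\mathrm{fv}(s)$; $v((\lambda x.s)u) \mapsto_{\sigma_3} (\lambda x.vs)u$ if $v$ value and $x \notin \mathrm{fv}(v)$. $\to_{\bar{\beta}_v}$, $\to_{\bar\sigma}$ are the closures of $\mapsto_{\beta_v}$ and of $\mapsto_{\sigma_1}\cup\mapsto_{\sigma_3}$ under balanced contexts, and $\to_{\bar{\mathsf{sh}}} = \to_{\bar\beta_v}\cup\to_{\bar\sigma}$. $\mathrm{leng}_{\beta_v}(t)$ is the number of $\bar\beta_v$-steps in any reduction sequence from $t$ to its $\bar{\mathsf{sh}}$-normal form (this number is independent of the sequence), and $\infty$ if $t$ is not $\bar{\mathsf{sh}}$-normalizable. Types: negative $N ::= P\multimap Q$; positive $P,Q ::= [N_1,\dots,N_n]$ finite multisets ($n\ge0$), $\mathbf{0}$ the empty multiset. Environments: maps from variables to positive types, $\mathbf{0}$ almost everywhere; $\uplus$ pointwise multiset sum; $\vdash t\colon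 P$ means the environment is everywhere $\mathbf{0}$. Rules: (ax) $x\colon P\vdash x\colon P$; (@) from $\Gamma\vdash t\colon[P\multimap Q]$ and $\Gamma'\vdash u\colon P$ infer $\Gamma\uplus\Gamma'\vdash tu\colon Q$; ($\lambda$) for $n\ge0$, from $\Gamma_i,x\colon P_i\vdash t\colon Q_i$ ($1\le i\le n$) infer $\biguplus_i\Gamma_i\vdash\lambda x.t\colon[P_1\multimap Q_1,\dots,P_n\multimap Q_n]$. The size $|\pi|$ of a derivation is its number of (@) rules. *)

(* Defs.v *)
From Stdlib Require Import List Relations SetoidPermutation PeanoNat.
Import ListNotations.

(** De Bruijn syntax, so that alpha-equivalence is equality. *)

Inductive term : Type :=
| Var (x : nat)
| Lam (t : term)
| App (t u : term).

Definition value (t : term) : Prop :=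
  match t with
  | Var _ | Lam _ => True
  | App _ _ => False
  end.

Definition scons {A : Type} (a : A) (f : nat -> A) (x : nat) : A :=
  match x with
  | 0 => a
  | S y => f y
  end.

Fixpoint rename (r : nat -> nat) (t : term) : term :=
  match t with
  | Var x => Var (r x)
  | Lam t => Lam (rename (scons 0 (fun y => S (r y))) t)
  | App t u => App (rename r t) (rename r u)
  end.

Definition shift : term -> term := rename S.

Fixpoint subst (s : nat -> term) (t : term) : term :=
  match t with
  | Var x => s x
  | Lam t => Lam (subst (scons (Var 0) (fun y => shift (s y))) t)
  | App t u => App (subst s t) (subst s u)
  end.

(** [t{v/x}], where [x] is the variable 0 of [t]. *)
Definition subst0 (v t : term) : term := subst (scons v Var) t.

Inductive root_betav : term -> term -> Prop :=
| betav_root t v : value v -> root_betav (App (Lam t) v) (subst0 v t).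

(** The side conditions [x] not free in [s] (resp. [v]) become shifts of the
    subterm that enters the scope of the abstraction. *)
Inductive root_sigma : term -> term -> Prop :=
| sigma1_root t u s :
    root_sigma (App (App (Lam t) u) s) (App (Lam (App t (shift s))) u)
| sigma3_root v s u : value v ->
    root_sigma (App v (App (Lam s) u)) (App (Lam (App (shift v) s)) u).

Inductive bctx : Type :=
| Hole
| CLamApp (B : bctx) (t : term)
| CAppL (B : bctx) (t : term)
| CAppR (t : term) (B : bctx).

(** Plugging may capture variables: no shift is performed. *)
Fixpoint plug (B : bctx) (r : term) : term :=
  match B with
  | Hole => r
  | CLamApp B t => App (Lam (plug B r)) t
  | CAppL B t => App (plug B r) t
  | CAppR t B => App t (plug B r)
  end.

Inductive bclos (R : relation term) : relation term :=
| bclos_intro B r r' : R r r' -> bclos R (plug B r) (plug B r').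

Definition step_betav : relation term := bclos root_betav.
Definition step_sigma : relation term := bclos root_sigma.
Definition step_sh : relation term := union term step_betav step_sigma.

Definition sh_normal (t : term) : Prop := forall u, ~ step_sh t u.

Definition sh_normalizable (t : term) : Prop :=
  exists u, clos_refl_trans term step_sh t u /\ sh_normal u.

(** [red_seq n t u]: there is an sh-reduction sequence from [t] to [u] with
    exactly [n] betav-steps (and any number of sigma-steps). *)
Inductive red_seq : nat -> term -> term -> Prop :=
| red_refl t : red_seq 0 t t
| red_betav n t u w : step_betav t u -> red_seq n u w -> red_seq (S n) t w
| red_sigma n t u w : step_sigma t u -> red_seq n u w -> red_seq n t w.

(** [is_leng t l]: the number of betav-steps in the sh-normalizing sequences
    from [t] is [l], with [None] standing for infinity.  Independence of the
    sequence is part of the meaning of [is_leng t (Some n)]. *)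
Definition is_leng (t : term) (l : option nat) : Prop :=
  match l with
  | Some n =>
      sh_normalizable t /\
      forall m u, red_seq m t u -> sh_normal u -> m = n
  | None => ~ sh_normalizable t
  end.

Lemma red_seq_of_star t u :
  clos_refl_trans term step_sh t u -> exists n, red_seq n t u.
Proof.
  intros H%clos_rt_rt1n.
  induction H as [|t w u [Hb | Hs] _ [n Hn]].
  - exists 0; constructor.
  - exists (S n); now apply red_betav with w.
  - exists n; now apply red_sigma with w.
Qed.

Lemma is_leng_unique t l l' : is_leng t l -> is_leng t l' -> l = l'.
Proof.
  destruct l as [n|], l' as [n'|]; simpl; try tauto.
  intros [[u [Hu Nu]] H] [_ H'].
  destruct (red_seq_of_star t u Hu) as [m Hm].
  now rewrite <- (H m u Hm Nu), <- (H' m u Hm Nu).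
Qed.

(** Finite multisets are represented by lists; two lists denote the same
    multiset when they are permutations of each other, hereditarily. *)

Inductive neg : Type :=
| Arrow (P Q : list neg).

Notation pos := (list neg).

Inductive neg_eq : neg -> neg -> Prop :=
| Arrow_eq P P' Q Q' :
    PermutationA neg_eq P P' -> PermutationA neg_eq Q Q' ->
    neg_eq (Arrow P Q) (Arrow P' Q').

Definition pos_eq : relation pos := PermutationA neg_eq.

(** Environments occurring in derivations are [[]] almost everywhere, since
    they are built by the typing rules from [env0] and [env1]. *)
Definition env : Type := nat -> pos.

Definition env0 : env := fun _ => [].
Definition env1 (x : nat) (P : pos) : env :=
  fun y => if Nat.eqb x y then P else [].
Definition env_sum (G G' : env) : env := fun x => G x ++ G' x.
Definition env_eq (G G' : env) : Prop := forall x, pos_eq (G x) (G' x).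

(** [derivs G t [P1 -o Q1; ...; Pn -o Qn]] packs the [n] premises
    [Gi, x : Pi |- t : Qi] of the abstraction rule, with [G] the sum of the
    [Gi]; the bound variable [x] is the variable 0 of [t].  The rule [d_conv]
    only identifies representations of the same multisets. *)
Inductive deriv : env -> term -> pos -> Type :=
| d_ax x P : deriv (env1 x P) (Var x) P
| d_app G G' t u P Q :
    deriv G t [Arrow P Q] -> deriv G' u P ->
    deriv (env_sum G G') (App t u) Q
| d_lam G t R : derivs G t R -> deriv G (Lam t) R
| d_conv G G' t P P' :
    env_eq G G' -> pos_eq P P' -> deriv G t P -> deriv G' t P'
with derivs : env -> term -> pos -> Type :=
| ds_nil t : derivs env0 t []
| ds_cons G G' t P Q R :
    deriv (scons P G) t Q -> derivs G' t R ->
    derivs (env_sum G G') t (Arrow P Q :: R).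

Fixpoint size {G t P} (d : deriv G t P) : nat :=
  match d with
  | d_ax _ _ => 0
  | d_app _ _ _ _ _ _ d1 d2 => S (size d1 + size d2)
  | d_lam _ _ _ ds => sizes ds
  | d_conv _ _ _ _ _ _ _ d1 => size d1
  end
with sizes {G t R} (ds : derivs G t R) : nat :=
  match ds with
  | ds_nil _ => 0
  | ds_cons _ _ _ _ _ _ d ds' => size d + sizes ds'
  end.

(* Main.v *)
Require Import Defs.
From Stdlib Require Import List Relations.
From Stdlib Require Import SetoidPermutation Permutation SetoidList.
From Stdlib Require Import Morphisms PeanoNat Lia.
Import ListNotations.

(** Quantitative subject reduction: a [betav]-step consumes exactly one
    application rule of a derivation and a [sigma]-step none.  A normal form
    typed in the empty environment is a value, since the leftmost subterm of
    an application cannot be a variable, and a value of type [[]] is typed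
    without application rules; so the size of the initial derivation is the
    number of [betav]-steps. *)

(** * Equality of multiset types *)

(** Types are nested through lists, so an inner fixpoint carries the recursion through the
    components of each arrow. *)
Fixpoint neg_eq_refl (N : neg) : neg_eq N N :=
  let fix pos_refl (P : pos) : PermutationA neg_eq P P :=
    match P with
    | [] => permA_nil neg_eq
    | N :: P => permA_skip (neg_eq_refl N) (pos_refl P)
    end in
  match N with Arrow P Q => Arrow_eq P P Q Q (pos_refl P) (pos_refl Q) end.

Fixpoint neg_eq_sym N N' (H : neg_eq N N') : neg_eq N' N :=
  let fix pos_sym P P' (H : PermutationA neg_eq P P') : PermutationA neg_eq P' P :=
    match H with
    | permA_nil _ => permA_nil neg_eq
    | permA_skip HN HP => permA_skip (neg_eq_sym _ _ HN) (pos_sym _ _ HP)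
    | permA_swap _ x y l => permA_swap neg_eq y x l
    | permA_trans H1 H2 => permA_trans (pos_sym _ _ H2) (pos_sym _ _ H1)
    end in
  match H with
  | Arrow_eq P P' Q Q' HP HQ => Arrow_eq P' P Q' Q (pos_sym _ _ HP) (pos_sym _ _ HQ)
  end.

Lemma neg_eq_trans N N' N'' : neg_eq N N' -> neg_eq N' N'' -> neg_eq N N''.
Proof.
  intros [P P' Q Q' HP HQ] H; inversion H; subst.
  constructor; econstructor; eassumption.
Qed.

Instance neg_eq_equiv : Equivalence neg_eq.
Proof. split; [exact neg_eq_refl | exact neg_eq_sym | exact neg_eq_trans]. Qed.

Instance pos_eq_equiv : Equivalence pos_eq.
Proof. unfold pos_eq; typeclasses eauto. Qed.

Lemma pos_eq_app P P' Q Q' : pos_eq P P' -> pos_eq Q Q' -> pos_eq (P ++ Q) (P' ++ Q').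
Proof. intros HP HQ; unfold pos_eq in *; now rewrite HP, HQ. Qed.

Lemma pos_eq_nil P : pos_eq [] P -> P = [].
Proof.
  intros H.
  assert (E : length (A := neg) [] = length P) by (induction H; simpl; congruence).
  now destruct P.
Qed.

(** A permutation up to [neg_eq] is a plain permutation followed by a pointwise equivalence: the
    first locates [N] in the intermediate list, the second gives its partner in [P']. *)
Lemma pos_eq_cons_inv N P P' : pos_eq (N :: P) P' ->
  exists N' P1 P2, P' = P1 ++ N' :: P2 /\ neg_eq N N' /\ pos_eq P (P1 ++ P2).
Proof.
  intros H. apply PermutationA_decompose in H; [|typeclasses eauto].
  destruct H as [l [Hp He]].
  destruct (Permutation_vs_cons_inv (Permutation_sym Hp)) as [l1 [l2 ->]].
  apply Permutation_cons_app_inv in Hp.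
  apply eqlistA_altdef, Forall2_app_inv_l in He as (P1 & P2 & H1 & H2 & ->).
  inversion H2 as [|? N' ? P3 HN H3]; subst.
  exists N', P1, P3; repeat split; auto.
  transitivity (l1 ++ l2).
  - apply Permutation_PermutationA; [typeclasses eauto | exact Hp].
  - apply pos_eq_app; apply eqlistA_PermutationA, eqlistA_altdef; assumption.
Qed.

Lemma pos_eq_arrow_singleton P Q P' Q' R :
  pos_eq (Arrow P Q :: R) [Arrow P' Q'] -> pos_eq P P' /\ pos_eq Q Q' /\ R = [].
Proof.
  intros H; apply pos_eq_cons_inv in H as (N & [|? [|]] & P2 & E & HN & HR);
    try discriminate.
  injection E as <- <-; inversion HN; subst.
  repeat split; auto. apply pos_eq_nil; symmetry; exact HR.
Qed.

(** * Environments under pointwise multiset sum *)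

Instance env_eq_equiv : Equivalence env_eq.
Proof.
  split.
  - intros G x; reflexivity.
  - intros G G' H x; symmetry; apply H.
  - intros G G' G'' H H' x; etransitivity; [apply H | apply H'].
Qed.

Instance env_sum_proper : Proper (env_eq ==> env_eq ==> env_eq) env_sum.
Proof. intros A A' HA B B' HB x; apply pos_eq_app; [apply HA | apply HB]. Qed.

Instance scons_proper : Proper (pos_eq ==> env_eq ==> env_eq) scons.
Proof. intros P P' HP G G' HG [|x]; [exact HP | apply HG]. Qed.

Lemma env_sum_comm A B : env_eq (env_sum A B) (env_sum B A).
Proof. intros x; apply PermutationA_app_comm; typeclasses eauto. Qed.

Lemma env_sum_assoc A B C :
  env_eq (env_sum A (env_sum B C)) (env_sum (env_sum A B) C).
Proof. intros x; unfold env_sum; now rewrite app_assoc. Qed.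

Lemma env_sum_0_r A : env_eq (env_sum A env0) A.
Proof. intros x; unfold env_sum, env0; now rewrite app_nil_r. Qed.

Lemma env_sum_swap A B C D :
  env_eq (env_sum (env_sum A B) (env_sum C D)) (env_sum (env_sum A C) (env_sum B D)).
Proof.
  rewrite <- (env_sum_assoc A B), (env_sum_assoc B C D), (env_sum_comm B C).
  now rewrite <- (env_sum_assoc C B D), env_sum_assoc.
Qed.

Lemma env_sum_swap_r A B C :
  env_eq (env_sum (env_sum A B) C) (env_sum (env_sum A C) B).
Proof. now rewrite <- !env_sum_assoc, (env_sum_comm B C). Qed.

Lemma env_sum_0_inv A B : env_eq env0 (env_sum A B) -> env_eq A env0 /\ env_eq B env0.
Proof.
  intros H; split; intros x; specialize (H x); apply pos_eq_nil in H;
    apply app_eq_nil in H as [HA HB]; [rewrite HA | rewrite HB]; reflexivity.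
Qed.

(** * Typing with the size as an index *)

(** [n] is the size of the derivation.  The premises of the abstraction rule
    are consumed one at a time, so that no mutual family is needed. *)
Inductive ty : nat -> env -> term -> pos -> Prop :=
| ty_ax x P : ty 0 (env1 x P) (Var x) P
| ty_app n m G G' t u P Q :
    ty n G t [Arrow P Q] -> ty m G' u P -> ty (S (n + m)) (env_sum G G') (App t u) Q
| ty_nil t : ty 0 env0 (Lam t) []
| ty_cons n m G G' t P Q R :
    ty n (scons P G) t Q -> ty m G' (Lam t) R ->
    ty (n + m) (env_sum G G') (Lam t) (Arrow P Q :: R)
| ty_conv n G G' t P P' :
    env_eq G G' -> pos_eq P P' -> ty n G t P -> ty n G' t P'.

Fixpoint ty_of_deriv {G t P} (d : deriv G t P) : ty (size d) G t P :=
  match d with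
  | d_ax x P => ty_ax x P
  | d_app _ _ _ _ _ _ d1 d2 => ty_app _ _ _ _ _ _ _ _ (ty_of_deriv d1) (ty_of_deriv d2)
  | d_lam _ _ _ ds => ty_of_derivs ds
  | d_conv _ _ _ _ _ HG HP d1 => ty_conv _ _ _ _ _ _ HG HP (ty_of_deriv d1)
  end
with ty_of_derivs {G t R} (ds : derivs G t R) : ty (sizes ds) G (Lam t) R :=
  match ds with
  | ds_nil t => ty_nil t
  | ds_cons _ _ _ _ _ _ d ds => ty_cons _ _ _ _ _ _ _ _ (ty_of_deriv d) (ty_of_derivs ds)
  end.

(** [ty_conv] keeps the size, so multiset equalities can be rewritten inside a typing. *)
Instance ty_proper : Proper (eq ==> env_eq ==> eq ==> pos_eq ==> iff) ty.
Proof.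
  intros n _ <- G G' HG t _ <- P P' HP; split; apply ty_conv; easy.
Qed.

Lemma ty_eq n n' G G' t P : ty n G t P -> n = n' -> env_eq G G' -> ty n' G' t P.
Proof. intros H <- HG; now rewrite <- HG. Qed.

(** * Inversion and splitting of typings *)

(** Any derivation may end with [ty_conv], so inversion goes by induction and holds up to multiset
    equality. *)
Lemma ty_var_inv n G x P : ty n G (Var x) P -> n = 0 /\ env_eq G (env1 x P).
Proof.
  intros H; remember (Var x) as t eqn:E; revert E.
  induction H as [| | | |n G G' t P P' HG HP _ IH]; intros E; try discriminate.
  - injection E as ->; easy.
  - destruct (IH E) as [-> IHG]; split; auto.
    rewrite <- HG, IHG; intros y; unfold env1; destruct (x =? y); easy.
Qed.

Lemma ty_app_inv n G t u Q : ty n G (App t u) Q ->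
  exists n1 n2 G1 G2 P, n = S (n1 + n2) /\ env_eq G (env_sum G1 G2) /\
    ty n1 G1 t [Arrow P Q] /\ ty n2 G2 u P.
Proof.
  intros H; remember (App t u) as s eqn:E; revert E.
  induction H as [|n m G G' t' u' P Q| | |n G G' t' Q Q' HG HQ _ IH];
    intros E; try discriminate.
  - injection E as -> ->; exists n, m, G, G', P; easy.
  - destruct (IH E) as (n1 & n2 & G1 & G2 & P & -> & HG' & Ht & Hu).
    exists n1, n2, G1, G2, P; repeat split; auto.
    + now rewrite <- HG.
    + eapply ty_conv; [reflexivity | | exact Ht].
      repeat constructor; [apply pos_eq_equiv | exact HQ].
Qed.

(** A singleton type means one premise of the abstraction rule: a [ty_cons] whose tail has type [[]]
    and, by [Hnil], adds neither size nor environment. *)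
Lemma ty_lam_inv n G t P Q : ty n G (Lam t) [Arrow P Q] -> ty n (scons P G) t Q.
Proof.
  assert (Hnil : forall n G t R, ty n G t R -> forall t', t = Lam t' -> R = [] ->
            n = 0 /\ env_eq G env0).
  { induction 1 as [| | | |n' G' G'' t' R R' HG HR _ IH]; try easy.
    intros t'' E ->; destruct (IH _ E) as [-> HG'].
    - apply pos_eq_nil; now symmetry.
    - now rewrite <- HG. }
  intros H; remember (Lam t) as s eqn:E; remember [Arrow P Q] as R eqn:ER.
  (* The type is generalized up to [pos_eq], since [ty_conv] may change the representing list. *)
  assert (HR : pos_eq R [Arrow P Q]) by now subst.
  clear ER; revert E HR.
  induction H as [| | |n m G G' t' P' Q' R Ht _ HR IH|n G G' t' R R' HG HR _ IH];
    intros E HR'; try discriminate.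
  - now apply pos_eq_nil in HR'.
  - apply pos_eq_arrow_singleton in HR' as (HP & HQ & ->).
    destruct (Hnil _ _ _ _ HR _ eq_refl eq_refl) as [-> HG].
    injection E as ->.
    rewrite Nat.add_0_r, HG, env_sum_0_r, <- HP, <- HQ; exact Ht.
  - rewrite <- HG; apply IH; auto; now rewrite HR.
Qed.

Lemma ty_lam n G t P Q : ty n (scons P G) t Q -> ty n G (Lam t) [Arrow P Q].
Proof.
  intros H; eapply ty_eq; [apply ty_cons; [exact H | apply ty_nil] | lia | apply env_sum_0_r].
Qed.

(** Applications inside an abstraction are counted only through its premises, and type [[]] leaves
    none. *)
Lemma ty_value_nil n G v : value v -> ty n G v [] -> n = 0 /\ env_eq G env0.
Proof.
  intros Hv H; remember [] as R eqn:E; revert E Hv.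
  induction H as [x P| | | |n G G' t P P' HG HP _ IH]; intros E Hv; try easy.
  - split; auto; subst; intros y; unfold env1; destruct (x =? y); easy.
  - subst; destruct IH as [-> HG']; auto.
    + apply pos_eq_nil; now symmetry.
    + now rewrite <- HG.
Qed.

(** The premises of a value can be dealt out between [R1] and [R2], one per arrow. An application
    has a single application rule, which could not be shared. *)
Lemma ty_value_split n G v R1 R2 : value v -> ty n G v (R1 ++ R2) ->
  exists n1 n2 G1 G2, n = n1 + n2 /\ env_eq G (env_sum G1 G2) /\
    ty n1 G1 v R1 /\ ty n2 G2 v R2.
Proof.
  intros Hv H; remember (R1 ++ R2) as R eqn:E.
  assert (HR : pos_eq R (R1 ++ R2)) by now subst.
  clear E; revert R1 R2 HR Hv.
  induction H as [x P| |t|n m G G' t P Q R Ht _ HR IH|n G G' t P P' HG HP _ IH];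
    intros R1 R2 HR' Hv; try easy.
  - exists 0, 0, (env1 x R1), (env1 x R2); repeat split; try constructor.
    intros y; unfold env_sum, env1; now destruct (x =? y).
  - apply pos_eq_nil, app_eq_nil in HR' as [-> ->].
    exists 0, 0, env0, env0; repeat split; try constructor.
  - apply pos_eq_cons_inv in HR' as (N & S1 & S2 & E & HN & HS).
    (* [ty_cons] adds an arrow at the head only; conversion then moves it to the place of [N]. *)
    assert (Hin : forall m' G0 A B, ty m' G0 (Lam t) (A ++ B) ->
              ty (n + m') (env_sum G G0) (Lam t) (A ++ N :: B)).
    { intros m' G0 A B H0. eapply ty_conv; [reflexivity | |].
      - apply PermutationA_middle; typeclasses eauto.
      - inversion HN as [P1 P' Q1 Q' HP HQ]; subst.
        apply ty_cons; auto; now rewrite <- HP, <- HQ. }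
    (* [N] is at the head of [R2], inside [R1], or further along in [R2]; the premise for it joins
       that part. *)
    apply app_eq_app in E as [l [[-> E]|[-> E]]].
    + destruct l as [|N' l]; simpl in E.
      * subst R2. rewrite app_nil_r.
        destruct (IH S1 S2 HS Hv) as (n1 & n2 & G1 & G2 & -> & HG & H1 & H2).
        exists n1, (n + n2), G1, (env_sum G G2); repeat split; [lia | | exact H1 |].
        -- rewrite HG, !env_sum_assoc; now rewrite (env_sum_comm G G1).
        -- now apply (Hin _ _ []).
      * injection E as <- ->. rewrite app_assoc in HS.
        destruct (IH _ _ HS Hv) as (n1 & n2 & G1 & G2 & -> & HG & H1 & H2).
        exists (n + n1), n2, (env_sum G G1), G2; repeat split; [lia | | | exact H2].
        -- now rewrite HG, !env_sum_assoc.
        -- now apply Hin.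
    + subst R2. rewrite <- app_assoc in HS.
      destruct (IH _ _ HS Hv) as (n1 & n2 & G1 & G2 & -> & HG & H1 & H2).
      exists n1, (n + n2), G1, (env_sum G G2); repeat split; [lia | | exact H1 |].
      -- rewrite HG, !env_sum_assoc; now rewrite (env_sum_comm G G1).
      -- now apply Hin.
  - destruct (IH R1 R2) as (n1 & n2 & G1 & G2 & -> & HG' & H12); auto.
    + now rewrite HP.
    + exists n1, n2, G1, G2; repeat split; try easy; now rewrite <- HG.
Qed.

(** * Typing under renaming and substitution *)

Definition env_insert (k : nat) (G : env) : env :=
  fun x => if x <? k then G x else if x =? k then [] else G (pred x).

Definition env_delete (k : nat) (G : env) : env :=
  fun x => G (if x <? k then x else S x).

Ltac nat_cases :=
  repeat match goal with
    | |- context [?x <? ?y] => destruct (Nat.ltb_spec x y)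
    | |- context [?x =? ?y] => destruct (Nat.eqb_spec x y)
    end; try lia.

(** Stated for a skip at any [k], and with [r] given by its values, so that the renaming lifted
    under a binder satisfies the hypothesis again at [S k]. *)
Lemma ty_rename n G t P : ty n G t P -> forall r k,
  (forall x, r x = if x <? k then x else S x) ->
  ty n (env_insert k G) (rename r t) P.
Proof.
  induction 1 as [x P|n m G G' t u P Q _ IHt _ IHu|t|n m G G' t P Q R _ IHt _ IHR
                 |n G G' t P P' HG HP _ IH]; intros r k Hr; simpl.
  - eapply ty_eq; [apply ty_ax | reflexivity |].
    intros y; rewrite Hr; unfold env_insert, env1; nat_cases; reflexivity.
  - eapply ty_eq; [eapply ty_app; eauto | reflexivity |].
    intros y; unfold env_insert, env_sum; nat_cases; reflexivity.
  - eapply ty_eq; [apply ty_nil | reflexivity |].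
    intros y; unfold env_insert, env0; nat_cases; reflexivity.
  - eapply ty_eq; [apply ty_cons; [|now apply IHR] | reflexivity |].
    + eapply ty_eq; [apply (IHt _ (S k)) | reflexivity |].
      * intros [|x]; simpl; auto. rewrite Hr.
        change (S x <? S k) with (x <? k); now destruct (x <? k).
      * instantiate (1 := env_insert k G).
        intros [|y]; [reflexivity|].
        unfold env_insert; simpl. change (S y <? S k) with (y <? k).
        nat_cases; try reflexivity. destruct y; [lia | reflexivity].
    + intros y; unfold env_insert, env_sum; nat_cases; reflexivity.
  - eapply ty_conv; [| exact HP | now apply IH].
    intros y; unfold env_insert; nat_cases; try apply HG; reflexivity.
Qed.

Lemma ty_shift n G t P : ty n G t P -> ty n (scons [] G) (shift t) P.
Proof.
  intros H; eapply ty_eq; [apply (ty_rename _ _ _ _ H S 0); easy | reflexivity |].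
  intros [|x]; reflexivity.
Qed.

Lemma value_shift v : value v -> value (shift v).
Proof. now destruct v. Qed.

(** Sizes add up because the derivation of the value is split among the typed occurrences of
    variable [k], each axiom receiving the part that matches its type. *)
Lemma ty_subst n G t Q : ty n G t Q -> forall s k m D,
  value (s k) -> (forall x, x < k -> s x = Var x) ->
  (forall x, k < x -> s x = Var (pred x)) -> ty m D (s k) (G k) ->
  ty (n + m) (env_sum (env_delete k G) D) (subst s t) Q.
Proof.
  induction 1 as [x P|n1 n2 G G' t u P Q _ IHt _ IHu|t|n1 n2 G G' t P Q R _ IHt _ IHR
                 |n G G' t P P' HG HP _ IH]; intros s k m D Hv Hlt Hgt HD.
  - destruct (Nat.eq_dec x k) as [->|Hne]; simpl.
    + unfold env1 in HD; rewrite Nat.eqb_refl in HD.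
      eapply ty_eq; [exact HD | reflexivity |].
      intros y; unfold env_sum, env_delete, env1; nat_cases; reflexivity.
    + unfold env1 in HD; rewrite (proj2 (Nat.eqb_neq x k) Hne) in HD.
      destruct (ty_value_nil _ _ _ Hv HD) as [-> HD0].
      (* For a variable other than [k], the value is typed with [[]] and contributes nothing. *)
      rewrite HD0, env_sum_0_r.
      destruct (Nat.lt_gt_cases x k) as [[Hx|Hx] _]; auto.
      * rewrite Hlt by assumption.
        eapply ty_eq; [apply ty_ax | reflexivity |].
        intros y; unfold env_delete, env1; nat_cases; reflexivity.
      * rewrite Hgt by assumption.
        eapply ty_eq; [apply ty_ax | reflexivity |].
        intros y; unfold env_delete, env1; nat_cases; reflexivity.
  (* The type of [k] is the sum of its types in the two premises. *)
  - destruct (ty_value_split _ _ _ _ _ Hv HD) as (m1 & m2 & D1 & D2 & -> & HD' & H1 & H2).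
    eapply ty_eq; [eapply ty_app; [apply (IHt s k) | apply (IHu s k)]; eauto | lia |].
    rewrite HD'; apply env_sum_swap.
  - destruct (ty_value_nil _ _ _ Hv HD) as [-> HD0].
    rewrite HD0; apply ty_nil.
  - destruct (ty_value_split _ _ _ _ _ Hv HD) as (m1 & m2 & D1 & D2 & -> & HD' & H1 & H2).
    eapply ty_eq; [apply ty_cons; [|apply (IHR s k); eauto] | |].
    + eapply ty_eq; [apply (IHt _ (S k) m1 (scons [] D1)) | reflexivity |].
      * now apply value_shift.
      * intros [|x] Hx; simpl; auto. rewrite Hlt by lia; reflexivity.
      * intros [|x] Hx; simpl; [lia|]. rewrite Hgt by lia.
        destruct x; [lia | reflexivity].
      * now apply ty_shift.
      (* The shifted value uses the bound variable with type [[]], so [P] is unchanged. *)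
      * instantiate (1 := env_sum (env_delete k G) D1).
        intros [|y]; unfold env_sum, env_delete; simpl.
        -- now rewrite app_nil_r.
        -- change (S y <? S k) with (y <? k); now destruct (y <? k).
    + lia.
    + rewrite HD'; apply env_sum_swap.
  - eapply ty_conv; [| exact HP | apply (IH s k m D); auto].
    + apply env_sum_proper; [|reflexivity].
      intros y; apply HG.
    + eapply ty_conv; [reflexivity | symmetry; apply HG | exact HD].
Qed.

(** * Quantitative subject reduction *)

Definition decreases (c : nat) (R : relation term) : Prop :=
  forall t u, R t u -> forall n G P, ty n G t P -> exists n', n = c + n' /\ ty n' G u P.

(** The application rule of the redex disappears, and substitution adds the sizes of its two
    premises. *)
Lemma root_betav_decreases : decreases 1 root_betav.
Proof.
  intros _ _ [t v Hv] n G P H.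
  apply ty_app_inv in H as (n1 & n2 & G1 & G2 & Q & -> & HG & Ht & H).
  apply ty_lam_inv in Ht.
  exists (n1 + n2); split; auto.
  eapply ty_eq; [apply (ty_subst _ _ _ _ Ht _ 0 n2 G2) | reflexivity |]; simpl; auto.
  - intros x; lia.
  - intros [|x]; [lia | reflexivity].
  - rewrite HG; reflexivity.
Qed.

(** Both sides combine the same three subderivations with two application rules; only the nesting
    changes, and shifting preserves size. *)
Lemma root_sigma_decreases : decreases 0 root_sigma.
Proof.
  intros _ _ [t u s|v s u Hv] n G P H.
  - apply ty_app_inv in H as (n1 & n2 & G1 & G2 & Q & -> & HG & H & Hs).
    apply ty_app_inv in H as (n3 & n4 & G3 & G4 & Q' & -> & HG1 & Ht & Hu).
    apply ty_lam_inv in Ht.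
    eexists; split; [|eapply ty_eq; [eapply ty_app; [apply ty_lam|exact Hu] | reflexivity |]].
    2: { eapply ty_eq; [eapply ty_app; [exact Ht | apply ty_shift, Hs] | reflexivity |].
         instantiate (1 := env_sum G3 G2). intros [|x]; unfold env_sum; simpl.
         - now rewrite app_nil_r.
         - reflexivity. }
    + lia.
    + rewrite HG, HG1; apply env_sum_swap_r.
  - apply ty_app_inv in H as (n1 & n2 & G1 & G2 & Q & -> & HG & Ht & H).
    apply ty_app_inv in H as (n3 & n4 & G3 & G4 & Q' & -> & HG2 & Hs & Hu).
    apply ty_lam_inv in Hs.
    eexists; split; [|eapply ty_eq; [eapply ty_app; [apply ty_lam|exact Hu] | reflexivity |]].
    2: { eapply ty_eq; [eapply ty_app; [apply ty_shift, Ht | exact Hs] | reflexivity |].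
         instantiate (1 := env_sum G1 G3). intros [|x]; reflexivity. }
    + lia.
    + rewrite HG, HG2; symmetry; apply env_sum_assoc.
Qed.

(** In a balanced context the hole is typed exactly once: it goes under an abstraction only when
    that abstraction is applied, hence has a singleton type. Under an arbitrary abstraction the
    number of premises could be any [n], and so could the number of typings of the hole. *)
Lemma bclos_decreases c R : decreases c R -> decreases c (bclos R).
Proof.
  intros HR _ _ [B r r' Hr]; induction B as [|B IH t|B IH t|t B IH]; simpl;
    [exact (HR _ _ Hr) | | |]; intros n G P H;
    apply ty_app_inv in H as (n1 & n2 & G1 & G2 & Q & -> & HG & H1 & H2).
  - apply ty_lam_inv, IH in H1 as (n' & -> & H1).
    exists (S (n' + n2)); split; [lia|].
    rewrite HG; eapply ty_app; [apply ty_lam, H1 | exact H2].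
  - apply IH in H1 as (n' & -> & H1).
    exists (S (n' + n2)); split; [lia|].
    rewrite HG; eapply ty_app; eauto.
  - apply IH in H2 as (n' & -> & H2).
    exists (S (n1 + n')); split; [lia|].
    rewrite HG; eapply ty_app; eauto.
Qed.

Lemma red_seq_ty m t u : red_seq m t u -> forall n G P, ty n G t P ->
  exists n', n = m + n' /\ ty n' G u P.
Proof.
  induction 1 as [t|m t u w Hs _ IH|m t u w Hs _ IH]; intros n G P H.
  - now exists n.
  - apply (bclos_decreases _ _ root_betav_decreases _ _ Hs) in H as (n' & -> & H).
    apply IH in H as (n'' & -> & H); now exists n''.
  - apply (bclos_decreases _ _ root_sigma_decreases _ _ Hs) in H as (n' & -> & H).
    apply IH in H as (n'' & -> & H); now exists n''.
Qed.

(** * Typed normal forms *)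

Lemma step_sh_appl t t' u : step_sh t t' -> step_sh (App t u) (App t' u).
Proof.
  intros [[B r r' Hr]|[B r r' Hr]]; [left | right];
    exact (bclos_intro _ (CAppL B u) r r' Hr).
Qed.

Lemma step_sh_appr t u u' : step_sh u u' -> step_sh (App t u) (App t u').
Proof.
  intros [[B r r' Hr]|[B r r' Hr]]; [left | right];
    exact (bclos_intro _ (CAppR t B) r r' Hr).
Qed.

(** In an application both parts would be normal and typed in the empty environment, hence values by
    induction. *)
Lemma sh_normal_ty_value u n P : sh_normal u -> ty n env0 u P -> value u.
Proof.
  revert n P; induction u as [x|t _|t IHt u IHu]; simpl; auto; intros n P Hn H.
  apply ty_app_inv in H as (n1 & n2 & G1 & G2 & Q & -> & HG & H1 & H2).
  apply env_sum_0_inv in HG as [HG1 HG2].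
  rewrite HG1 in H1; rewrite HG2 in H2.
  assert (Ht : value t).
  { eapply IHt; [|exact H1]. intros t' Hs; eapply Hn, step_sh_appl, Hs. }
  assert (Hu : value u).
  { eapply IHu; [|exact H2]. intros u' Hs; eapply Hn, step_sh_appr, Hs. }
  destruct t as [x|t|]; [| |easy].
  (* The axiom would put a nonempty type at [x] in the empty environment. *)
  - apply ty_var_inv in H1 as [_ H1]. specialize (H1 x).
    apply pos_eq_nil in H1. unfold env1 in H1; now rewrite Nat.eqb_refl in H1.
  - apply (Hn (subst0 u t)). left.
    exact (bclos_intro _ Hole _ _ (betav_root t u Hu)).
Qed.

(** Root redexes are applications, and balanced contexts never enter an abstraction that is not
    applied. *)
Lemma value_sh_normal v : value v -> sh_normal v.
Proof.
  intros Hv u [H|H]; inversion H as [B r r' Hr E]; subst;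
    destruct B; try easy; now destruct Hr.
Qed.

Theorem theorem5p6 (t v : term) (Hv : value v)
  (Hred : clos_refl_trans term step_sh t v)
  (d : deriv env0 t []) :
  is_leng t (Some (size d)).
Proof.
  split.
  - exists v; split; [exact Hred | now apply value_sh_normal].
  - intros m u Hm Hu.
    destruct (red_seq_ty _ _ _ Hm _ _ _ (ty_of_deriv d)) as (n & -> & H).
    (* The size [n] left after the [m] betav-steps is that of a value of type [[]], namely 0. *)
    destruct (ty_value_nil n env0 u) as [-> _]; auto.
    now apply (sh_normal_ty_value u n []).
Qed.
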